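(* Let $m\geq 1$ and $n\geq m$ be integers. Let $G$ be an edge-colored complete graph on $n$ vertices obtained as follows: $G$ contains a copy of $T_{n-m+1}$ on some $n-m+1$ of its vertices, and every edge of $G$ not in $T_{n-m+1}$ receives a unique color (a color used on no other edge of $G$). Then $$c(G)= mn-\binom{m+1}{2},\qquad e(G)+c(G)=\binom{n}{2}+mn-\binom{m+1}{2},$$ and $G$ does not contain a proper $mK_3$. Moreover, if $m>1$ and $n\geq 5m$, then $$\binom{n}{2}+mn-\binom{m+1}{2} > \binom{n}{2}+n+6m-7.$$ Consequently, the assertion ''every edge-colored graph $H$ on $n\ge 5m$ vertices with $e(H)+c(H)\ge \binom{n+1}{2}+6m-6$ contains a proper $mK_3$'' is false.
   Context: All graphs are finite and simple. An edge-colored graph is a graph $G$ together with an arbitrary map $C:E(G)\to\mathbb{N}$ (not necessarily a proper coloring). $e(G)=|E(G)|$ is the number of edges, and $c(G)=|C(E(G))|$ is the number of distinct colors appearing on the edges of $G$. An edge-colored graph is rainbow if no two of its edges share the same color. A proper $mK_3$ is a union of $m$ pairwise vertex-disjoint rainbow triangles (each triangle is rainbow; different triangles may share colors). For $N\geq 1$, $T_N$ denotes the edge-colored complete graph with vertex set $\{v_1,\dots,v_N\}$ and coloring $C(v_iv_j)=i$ for $1\leq i<j\leq N$ (so it uses the $N-1$ colors $1,\dots,N-1$). *)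

(* Defs.v *)
From HB Require Import structures.
From mathcomp Require Import all_boot.

Set Implicit Arguments.
Unset Strict Implicit.
Unset Printing Implicit Defensive.

(* Edges are 2-element vertex sets.  The coloring is a total function on
   vertex sets, but every definition below only uses its values on edges. *)
Record ecgraph (V : finType) := ECGraph {
  edges : {set {set V}};
  color : {set V} -> nat;
  edges_card2 : forall e, e \in edges -> #|e| = 2
}.

Definition colors (V : finType) (G : ecgraph V) : seq nat :=
  undup [seq color G e | e in edges G].

Definition num_edges (V : finType) (G : ecgraph V) : nat := #|edges G|.

Definition num_colors (V : finType) (G : ecgraph V) : nat := size (colors G).

Definition complete (V : finType) (G : ecgraph V) : Prop :=
  edges G = [set e : {set V} | #|e| == 2].

Definition rainbow (V : finType) (G : ecgraph V) : Prop :=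
  {in edges G &, injective (color G)}.

Lemma induced_card2 (V : finType) (G : ecgraph V) (S : {set V}) :
  forall e, e \in [set e in edges G | e \subset S] -> #|e| = 2.
Proof. by move=> e; rewrite inE => /andP[/edges_card2]. Qed.

Definition induced (V : finType) (G : ecgraph V) (S : {set V}) : ecgraph V :=
  ECGraph (color G) (@induced_card2 V G S).

Definition rainbow_triangle (V : finType) (G : ecgraph V) (S : {set V}) : Prop :=
  [/\ #|S| = 3,
      forall e : {set V}, e \subset S -> #|e| = 2 -> e \in edges G &
      rainbow (induced G S)].

Definition has_proper_mK3 (V : finType) (m : nat) (G : ecgraph V) : Prop :=
  exists2 t : 'I_m -> {set V},
    forall i, rainbow_triangle G (t i) &
    forall i j, i != j -> [disjoint t i & t j].

Lemma complete_card2 (V : finType) :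
  forall e, e \in [set e : {set V} | #|e| == 2] -> #|e| = 2.
Proof. by move=> e; rewrite inE => /eqP. Qed.

(* The vertex v_k is the ordinal k - 1, so v_i v_j with i < j gets as color the
   least 1-based index of its endpoints; see Tgraph_color. *)
Definition Tgraph (N : nat) : ecgraph 'I_N :=
  ECGraph (fun e : {set 'I_N} => \big[minn/N]_(k in e) k.+1)
          (@complete_card2 'I_N).

Lemma Tgraph_color (N : nat) (i j : 'I_N) :
  i < j -> color (Tgraph N) [set i; j] = i.+1.
Proof.
move=> ltij; apply/eqP; rewrite eqn_leq /=; apply/andP; split; last first.
  apply: (big_ind (fun x => i < x)) => [||k].
  - exact: ltn_ord.
  - by move=> x y ix iy; rewrite leq_min ix.
  - by rewrite !inE => /orP[] /eqP -> //; rewrite ltnS ltnW.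
elim: (index_enum _) (mem_index_enum i) => // k s IHs.
rewrite big_cons inE => /predU1P[<-|/IHs le_s]; first by rewrite !inE eqxx geq_minl.
by case: ifP => // _; rewrite geq_min le_s orbT.
Qed.

(* f places a copy of H in G.  The names of the colors are immaterial: they may
   be changed by a map r which keeps distinct colors of H distinct. *)
Definition copy_in (U V : finType) (H : ecgraph U) (G : ecgraph V)
    (f : U -> V) : Prop :=
  [/\ injective f,
      {in edges H, forall e : {set U}, f @: e \in edges G} &
      exists2 r : nat -> nat, {in colors H &, injective r} &
        {in edges H, forall e : {set U}, color G (f @: e) = r (color H e)}].

Definition unique_color (V : finType) (G : ecgraph V) (e : {set V}) : Prop :=
  {in edges G, forall e' : {set V}, color G e' = color G e -> e' = e}.

Definition T_extension (N : nat) (V : finType) (G : ecgraph V) : Prop :=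
  complete G /\
  exists2 f : 'I_N -> V, copy_in (Tgraph N) G f &
    forall e, e \in edges G ->
      e \notin [set f @: d | d : {set 'I_N} in edges (Tgraph N)] -> unique_color G e.

(* Main.v *)
Require Import Defs.
From HB Require Import structures.
From mathcomp Require Import all_boot.
From mathcomp Require Import zify.

(** In T_N two edges with the same least endpoint have the same color, so T_N
    has no rainbow triangle: every rainbow triangle of G uses one of the m - 1
    vertices outside the copy of T_(n-m+1), and m disjoint ones cannot exist. *)

Lemma set2_ltP (N : nat) (e : {set 'I_N}) :
  #|e| = 2 -> exists i j : 'I_N, i < j /\ e = [set i; j].
Proof.
move/eqP/cards2P=> [x [y [nxy ->]]].
have [lt|lt|eq] := ltngtP x y; first by exists x, y.
- by exists y, x; split=> //; rewrite setUC.
- by case/eqP: nxy; apply: val_inj.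
Qed.

Lemma set3_ltP (N : nat) (S : {set 'I_N}) :
  #|S| = 3 -> exists i j k : 'I_N,
    [/\ i < j, j < k & [/\ i \in S, j \in S & k \in S]].
Proof.
move=> S3; have [i iS]: exists i, i \in S by apply/set0Pn; rewrite -card_gt0 S3.
pose a := [arg min_(x < i in S) (x : nat)].
have [aS amin] : a \in S /\ forall x, x \in S -> a <= x.
  by rewrite /a; case: arg_minnP.
have S2 : #|S :\ a| = 2 by move: S3; rewrite (cardsD1 a) aS => -[].
have [j [k [ltjk eS]]] := set2_ltP _ _ S2.
have : j \in S :\ a by rewrite eS !inE eqxx.
have : k \in S :\ a by rewrite eS !inE eqxx orbT.
rewrite !inE => /andP[_ kS] /andP[nja jS].
exists a, j, k; split=> //; rewrite ltn_neqAle amin // andbT.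
by apply: contra nja => /eqP /val_inj ->.
Qed.

(** The bound holds for every vertex set, the empty set getting the default [N] of the minimum. It
    leaves all numbers above [N] free for the edges outside a copy. *)
Lemma Tgraph_color_le (N : nat) (e : {set 'I_N}) : color (Tgraph N) e <= N.
Proof.
apply: (big_ind (fun x => x <= N)) => //= x y xN yN.
by rewrite geq_min xN.
Qed.

Lemma mem_colors (V : finType) (G : ecgraph V) (c : nat) :
  reflect (exists2 e, e \in edges G & c = color G e) (c \in colors G).
Proof. by rewrite mem_undup; apply: imageP. Qed.

Lemma Tgraph_num_colors (N : nat) : num_colors (Tgraph N) = N.-1.
Proof.
rewrite -(size_iota 1 N.-1); apply/eqP.
rewrite -(uniq_size_uniq (iota_uniq 1 N.-1)) ?undup_uniq // => c.
rewrite mem_iota; apply/idP/mem_colors => [|[e]].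
  (* Color [c.+1] appears on the edge joining the consecutive indices [c] and [c.+1]; color 0 is out
     of range because [iota] starts at 1. *)
  case: c => [|c] // lt_c.
  have c1N : c.+1 < N by lia.
  pose i := Ordinal (ltnW c1N); pose j := Ordinal c1N.
  have ltij : i < j by [].
  exists [set i; j]; last by rewrite (Tgraph_color ltij).
  by rewrite inE cards2 neq_ltn ltij.
rewrite inE => /eqP/set2_ltP [i [j [ltij ->]]] ->; rewrite Tgraph_color //.
by have := ltn_ord j; lia.
Qed.

(** The edges split into those of the copy, which show the [N.-1] colors of T_N up to renaming, and
    the others, each with a color of its own. The additive form avoids truncated subtraction. *)
Lemma T_extension_num_colors (N : nat) (V : finType) (G : ecgraph V) :
  T_extension N G -> num_colors G + 'C(N, 2) = N.-1 + 'C(#|V|, 2).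
Proof.
case=> cG [f [injf fE [r injr fr]] uniqG].
pose D := [set f @: d | d : {set 'I_N} in edges (Tgraph N)].
have sDG : D \subset edges G by apply/subsetP=> _ /imsetP [d dT ->]; apply: fE.
have cardD : #|D| = 'C(N, 2).
  by rewrite card_imset ?card_draws ?card_ord //; apply: imset_inj.
have cardG : #|edges G| = 'C(#|V|, 2) by rewrite cG card_draws.
pose s1 := map r (colors (Tgraph N)).
pose s2 := [seq color G e | e in edges G :\: D].
have outP e : e \in edges G :\: D -> e \in edges G /\ unique_color G e.
  by rewrite inE => /andP[eD eG]; split=> //; apply: uniqG.
have uniq12 : uniq (s1 ++ s2).
  rewrite cat_uniq map_inj_in_uniq // undup_uniq /=; apply/andP; split.
    apply/hasPn=> _ /imageP [e eGD ->]; apply/negP=> /mapP [_ /mem_colors[d dT ->]].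
    (* An outside edge colored like a copied edge [f @: d] would equal it, by uniqueness of its
       color. *)
    have [eG ue] := outP _ eGD; rewrite -fr // => /esym/ue fde.
    by case/setDP: eGD => _ /negP[]; rewrite -fde ?fE //; apply: imset_f.
  rewrite map_inj_in_uniq ?enum_uniq // => e e'.
  rewrite !mem_enum => /outP [eG _] /outP [e'G ue'].
  exact: ue'.
have eq12 : colors G =i s1 ++ s2.
  move=> c; rewrite mem_cat; apply/mem_colors/orP=> [[e eG ->]|].
    have [/imsetP [d dT ->]|eD] := boolP (e \in D).
      by left; rewrite fr //; apply: map_f; apply/mem_colors; exists d.
    by right; apply: image_f; apply/setDP.
  case=> [/mapP [_ /mem_colors[d dT ->] ->]|/imageP [e /outP [eG _] ->]].
    by exists (f @: d); rewrite ?fE ?fr.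
  by exists e.
have -> : num_colors G = size (s1 ++ s2).
  by apply: perm_size; apply: uniq_perm; rewrite ?undup_uniq.
rewrite size_cat size_map -/(num_colors _) Tgraph_num_colors size_map -cardE.
by rewrite cardsD (setIidPr sDG) cardD cardG -addnA subnK // -cardD -cardG subset_leq_card.
Qed.

Lemma copy_Tgraph_no_rainbow_triangle (N : nat) (V : finType) (G : ecgraph V)
    (f : 'I_N -> V) (S : {set V}) :
  copy_in (Tgraph N) G f -> rainbow_triangle G S -> ~~ (S \subset f @: setT).
Proof.
case=> injf fE [r _ fr] [S3 SG rb]; apply/negP=> sSf.
(* [S] is the image of its preimage, so the preimage also has three elements and can be sorted as i
   < j < k. *)
have eS : S = f @: (f @^-1: S).
  apply/setP=> x; apply/idP/imsetP=> [xS|[k]]; last by rewrite inE => ? ->.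
  by have /imsetP [k _ xk] := subsetP sSf _ xS; exists k; rewrite ?inE -?xk.
have := S3; rewrite eS card_imset // => /set3_ltP [i [j [k [ltij ltjk []]]]].
rewrite !inE => iS jS kS.
have ltik := ltn_trans ltij ltjk.
have edgeT (a b : 'I_N) : a < b -> [set a; b] \in edges (Tgraph N).
  by move=> ltab; rewrite inE cards2 neq_ltn ltab.
have edgeS (a b : 'I_N) : a < b -> f a \in S -> f b \in S ->
    f @: [set a; b] \in edges (induced G S).
  move=> ltab aS bS; rewrite inE fE ?edgeT //=.
  by apply/subsetP=> _ /imsetP [c /set2P [] -> ->].
(* The edges ij and ik of T_N share the color [i.+1], so rainbowness makes them equal and forces k
   to be i or j. *)
have := rb _ _ (edgeS i j ltij iS jS) (edgeS i k ltik iS kS).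
rewrite /= !fr ?edgeT // !Tgraph_color // => /(_ erefl) /(imset_inj injf) /setP /(_ k).
by rewrite !inE eqxx orbT => /orP[] /eqP ek; move: ltik ltjk; rewrite ek ltnn.
Qed.

(** Choosing a point of [W] in each [t i] is injective: a point chosen for two indices would lie in
    two disjoint sets. *)
Lemma disjoint_transversal_leq_card (V : finType) (m : nat)
    (t : 'I_m -> {set V}) (W : {set V}) :
  (forall i j, i != j -> [disjoint t i & t j]) ->
  (forall i, exists2 x, x \in t i & x \in W) -> m <= #|W|.
Proof.
move=> dt tW; have tW' i : exists x, (x \in t i) && (x \in W).
  by have [x xt xW] := tW i; exists x; rewrite xt.
pose g i := xchoose (tW' i).
have gP i : g i \in t i /\ g i \in W by apply/andP/(xchooseP (tW' i)).
have injg : injective g.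
  move=> i j eg; apply/eqP; apply/negPn/negP=> /dt /pred0P /(_ (g i)) /=.
  by have [-> _] := gP i; rewrite eg; have [-> _] := gP j.
rewrite -[m]card_ord -cardsT -(card_imset _ injg).
by apply: subset_leq_card; apply/subsetP=> _ /imsetP [i _ ->]; have [] := gP i.
Qed.

Lemma T_extension_no_proper_mK3 (N m : nat) (V : finType) (G : ecgraph V) :
  #|V| < N + m -> T_extension N G -> ~ has_proper_mK3 m G.
Proof.
move=> ltV [_ [f cf _]] [t rt dt].
(* The complement of the copy has [#|V| - N] vertices, fewer than [m]. *)
have : m <= #|~: (f @: setT)|.
  apply: disjoint_transversal_leq_card dt _ => i.
  have /subsetPn [x xt xf] := copy_Tgraph_no_rainbow_triangle _ _ _ _ _ cf (rt i).
  by exists x; rewrite ?inE.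
have [injf _ _] := cf.
have := cardsC (f @: setT); rewrite card_imset // cardsT card_ord; lia.
Qed.

(** Supplies the counterexample. A copied edge takes the T_N color of its preimage, at most [N]; any
    other edge takes [N.+1] plus its rank among all vertex sets, so no other edge has its color. *)
Lemma T_extension_exists (N : nat) (V : finType) (f : 'I_N -> V) :
  injective f -> exists G : ecgraph V, T_extension N G.
Proof.
move=> injf; pose D := [set f @: d | d : {set 'I_N} in edges (Tgraph N)].
pose col e := if e \in D then color (Tgraph N) (f @^-1: e)
              else N.+1 + enum_rank e.
exists (ECGraph col (@complete_card2 V)); split=> //; exists f; first split=> //.
- by move=> e; rewrite !inE card_imset.
- exists id => // e eT; rewrite /= /col imset_f //; congr (color (Tgraph N) _).
  by apply/setP=> k; rewrite inE mem_imset.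
move=> e eG eD e' e'G /=; rewrite /col (negbTE eD).
case: ifP => _ eq; last by apply/enum_rank_inj/val_inj/eqP; rewrite -(eqn_add2l N.+1) eq.
by have := Tgraph_color_le N (f @^-1: e'); rewrite eq; lia.
Qed.

(** Clears the division by two, so that [lia] and [nia] can treat the binomials as variables. *)
Lemma bin2_double (k : nat) : 'C(k, 2) * 2 = k * k.-1.
Proof. by rewrite -[2]/(2`!) bin_ffact ffactnS ffactn1. Qed.

Theorem mainTheorem3 (m n : nat) (hm : 1 <= m) (hmn : m <= n) :
  (forall (V : finType) (G : ecgraph V),
     #|V| = n -> T_extension (n - m + 1) G ->
     [/\ num_colors G = m * n - 'C(m + 1, 2),
         num_edges G + num_colors G = 'C(n, 2) + m * n - 'C(m + 1, 2) &
         ~ has_proper_mK3 m G]) /\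
  (1 < m -> 5 * m <= n ->
     'C(n, 2) + m * n - 'C(m + 1, 2) > 'C(n, 2) + n + 6 * m - 7 /\
     ~ (forall (V : finType) (H : ecgraph V),
          #|V| = n ->
          num_edges H + num_colors H >= 'C(n + 1, 2) + 6 * m - 6 ->
          has_proper_mK3 m H)).
Proof.
have bm := bin2_double (m + 1); have bn := bin2_double n.
have bN := bin2_double (n - m + 1).
have ext (V : finType) (G : ecgraph V) :
     #|V| = n -> T_extension (n - m + 1) G ->
     [/\ num_colors G = m * n - 'C(m + 1, 2),
         num_edges G + num_colors G = 'C(n, 2) + m * n - 'C(m + 1, 2) &
         ~ has_proper_mK3 m G].
  move=> cV TG.
  have cG : num_edges G = 'C(n, 2).
    by case: TG => cG _; rewrite /num_edges cG card_draws cV.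
  have := T_extension_num_colors _ _ _ TG; rewrite cV => nc.
  (* With n = m + k the copy has k + 1 vertices, and the color count [nc] becomes free of truncated
     subtraction. *)
  have [k en] : exists k, n = m + k by exists (n - m); lia.
  have eN : n - m = k by lia.
  rewrite eN !addn1 /= in bN bm nc; rewrite addn1.
  have bn' : 'C(n, 2) * 2 + n = n * n.
    by rewrite bn; case: (n) => // p; rewrite /= !mulSn mulnS; lia.
  have e1 : num_colors G + 'C(m.+1, 2) = m * n.
    move: bN bm bn' nc; rewrite en; clear; move: 'C(_, 2) => a.
    by move: 'C(m + k, 2) 'C(m.+1, 2) => b c; lia.
  by split; [lia|rewrite cG; lia|apply: T_extension_no_proper_mK3 TG; lia].
split=> // m1 n5.
have gt : 'C(n, 2) + m * n - 'C(m + 1, 2) > 'C(n, 2) + n + 6 * m - 7.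
  rewrite addn1 /= in bm *.
  suff : n + 6 * m + 'C(m.+1, 2) < m * n + 7 by lia.
  (* With m = p + 2 and n = 5m + q, twice the right side minus twice the left side is (p + 1)(9p +
     2q + 4), which is positive. *)
  have [p em] : exists p, m = p + 2 by exists (m - 2); lia.
  have [q en] : exists q, n = 5 * m + q by exists (n - 5 * m); lia.
  move: bm; rewrite en em; clear; move: 'C(_, 2) => a.
  by nia.
split=> // all; have leNn : n - m + 1 <= n by lia.
have [G TG] : exists G : ecgraph 'I_n, T_extension (n - m + 1) G.
  apply: (T_extension_exists _ _ (widen_ord leNn)) => i j /(congr1 val) /= eij.
  exact: val_inj.
have [_ eG []] := ext _ G (card_ord n) TG.
apply: all; first exact: card_ord.
(* Since C(n + 1, 2) = C(n, 2) + n, the required bound is one more than the smaller side of [gt],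
   which the strict inequality covers. *)
by rewrite eG addn1 binS bin1; lia.
Qed.
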